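(* Let $X$ be a topological space and $p\in X$. Then Alice has a winning strategy in $\mathsf{G}_{\mathrm{bnd}}(\Omega_p,\Omega_p)$ if, and only if, Alice has a winning strategy in $\mathsf{G}_k(\Omega_p,\Omega_p)$ for every $k\in\mathbb{N}$.
   Context: Here $\omega=\{0,1,2,\dots\}$ and $\mathbb{N}=\omega\setminus\{0\}$. For a topological space $X$ and $p\in X$, $\Omega_p=\{Y\subset X: p\in\overline{Y}\}$. Let $\mathcal{A},\mathcal{B}$ be families of sets. The following games are played between Alice and Bob, with innings $n\in\omega$; in each inning $n$ Alice first chooses $A_n\in\mathcal{A}$ and then Bob responds with a finite $B_n\subset A_n$, each player knowing all previous moves. In $\mathsf{G}_k(\mathcal{A},\mathcal{B})$ ($k\in\mathbb{N}$), Bob must choose $|B_n|\le k$ in every inning, and Bob wins if $\bigcup_{n\in\omega}B_n\in\mathcal{B}$; otherwise Alice wins. In $\mathsf{G}_{\mathrm{bnd}}(\mathcal{A},\mathcal{B})$, Bob wins if $\bigcup_{n\in\omega}B_n\in\mathcal{B}$ and there is a $k\in\omega$ such that $|B_n|\le k$ for every $n\in\omega$; otherwise Alice wins. *)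

(* Defs.v *)
From mathcomp Require Import all_boot finmap all_classical topology.

Set Implicit Arguments.
Unset Strict Implicit.
Unset Printing Implicit Defensive.

Local Open Scope classical_set_scope.

Definition Omega_at (X : topologicalType) (p : X) : set (set X) :=
  [set Y | closure Y p].

(* A strategy answers the finite sequence [:: B_0; ...; B_(n-1)] of Bob's
   moves so far with A_n; Alice's own earlier moves are determined by the
   strategy and by that sequence.  As the strategy is a total function, it also
   has values on sequences that no play produces; requiring these to lie in
   calA as well is harmless when calA is nonempty, and Omega_at p always is. *)
Definition alice_strategy (X : choiceType) := seq {fset X} -> set X.

Definition alice_move (X : choiceType) (sigma : alice_strategy X)
    (B : nat -> {fset X}) (n : nat) : set X :=
  sigma (mkseq B n).

Definition union_of_moves (X : choiceType) (B : nat -> {fset X}) : set X :=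
  \bigcup_(n in [set: nat]) [set` B n].

(* The parameter [rule] is the restriction on each single move of Bob, and
   [bob_wins] is the condition under which Bob wins a completed play. *)
Definition alice_winning (X : choiceType) (calA : set (set X))
    (rule : {fset X} -> Prop) (bob_wins : (nat -> {fset X}) -> Prop)
    (sigma : alice_strategy X) : Prop :=
  (forall s : seq {fset X}, calA (sigma s)) /\
  (forall B : nat -> {fset X},
     (forall n, [set` B n] `<=` alice_move sigma B n /\ rule (B n)) ->
     ~ bob_wins B).

Definition alice_wins_Gk (X : choiceType) (k : nat) (calA calB : set (set X)) :
    Prop :=
  exists sigma : alice_strategy X,
    alice_winning calA (fun F => #|` F| <= k)
      (fun B => calB (union_of_moves B)) sigma.

Definition alice_wins_Gbnd (X : choiceType) (calA calB : set (set X)) : Prop :=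
  exists sigma : alice_strategy X,
    alice_winning calA (fun _ => True)
      (fun B => calB (union_of_moves B) /\
                exists k : nat, forall n, #|` B n| <= k) sigma.

(* Main.v *)
Require Import Defs.
From mathcomp Require Import all_boot finmap all_classical topology.

(** Only the implication from right to left has content.  Let Alice hold a
    strategy [sigma m] beating every Bob who selects at most [m.+1] points per
    inning.  She does not know Bob's bound in advance, but she can always act as
    if it were the largest number [m] of points he has selected at once so far:
    she follows [sigma m], and forgets the past and starts the appropriate new
    strategy from scratch each time Bob exceeds [m].

    If Bob's moves are bounded, [m] changes finitely often
    ([eventually_one_strategy]).  From the last change on, Bob is playing a legal
    run against a single winning strategy, so the points selected from then on do
    not have [p] in their closure.  The remaining points lie in finitely many
    finite moves.  None of these can accumulate at [p] either: since closure
    commutes with finite unions, otherwise Bob would have been offered a single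
    point [x] with [p] in the closure of [x], at a position reached legally
    against some [sigma m]; selecting [x] alone there, and nothing afterwards,
    would have beaten [sigma m] ([offered_points_far]).  This is why each
    [sigma m] has to allow Bob at least one point.  Finally, deleting finitely
    many non-accumulating moves does not affect accumulation at [p]
    ([closure_tail]). *)

Set Implicit Arguments.
Unset Strict Implicit.
Unset Printing Implicit Defensive.

Local Open Scope classical_set_scope.

(** * Accumulation at a point *)

Lemma closure_seq (X : topologicalType) (p : X) (s : seq X) :
  closure [set` s] p -> exists2 x, x \in s & closure [set x] p.
Proof.
elim: s => [|x s IHs].
  by move=> /(_ setT filterT) [y []].
have -> : [set` x :: s] = [set x] `|` [set` s].
  apply/seteqP; split=> y /=; rewrite inE.
    by case/orP=> [/eqP|]; [left | right].
  by case=> [->|->]; rewrite ?eqxx ?orbT.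
rewrite closureU => -[px|/IHs [y ys py]].
  by exists x => //; rewrite mem_head.
by exists y => //; rewrite inE ys orbT.
Qed.

Lemma closure_tail (X : topologicalType) (p : X) (B : nat -> {fset X}) N :
  (forall n, ~ closure [set` B n] p) -> closure (union_of_moves B) p ->
  closure (union_of_moves (fun n => B (N + n))) p.
Proof.
move=> Bfar pB; elim: N => [//|N IHN].
have : closure ([set` B N] `|` union_of_moves (fun n => B (N.+1 + n))) p.
  apply: closureS IHN => x [[|n] _ xB]; first by left; rewrite addn0 in xB.
  by right; exists n => //=; rewrite addSnnS.
by rewrite closureU => -[/Bfar|].
Qed.

(** * Positions reached by legal play *)

Definition legal_position (X : choiceType) (rule : {fset X} -> Prop)
    (sigma : alice_strategy X) (t : seq {fset X}) : Prop :=
  forall i, i < size t ->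
    [set` nth fset0 t i] `<=` sigma (take i t) /\ rule (nth fset0 t i).

Lemma legal_position_rcons (X : choiceType) (rule : {fset X} -> Prop)
    (sigma : alice_strategy X) (t : seq {fset X}) (F : {fset X}) :
  legal_position rule sigma t -> [set` F] `<=` sigma t -> rule F ->
  legal_position rule sigma (rcons t F).
Proof.
move=> legt Fsub ruleF i; rewrite size_rcons ltnS nth_rcons -cats1.
rewrite leq_eqVlt => /orP[/eqP ->|lti].
  by rewrite ltnn eqxx take_size_cat.
by rewrite lti takel_cat 1?ltnW //; exact: legt.
Qed.

(** Bob can stop selecting points at any time, so a winning strategy of Alice
    already wins at every finite position. *)
Lemma legal_position_lost (X : choiceType) (calA : set (set X))
    (rule : {fset X} -> Prop) (bob_wins : (nat -> {fset X}) -> Prop)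
    (sigma : alice_strategy X) (t : seq {fset X}) :
  rule fset0 -> alice_winning calA rule bob_wins sigma ->
  legal_position rule sigma t -> ~ bob_wins (nth fset0 t).
Proof.
move=> rule0 [_ win] legt; apply: win => n; rewrite /alice_move.
have [ltn|gen] := ltnP n (size t); last first.
  by rewrite nth_default //; split=> // x /=; rewrite inE.
suff -> : mkseq (nth fset0 t) n = take n t by exact: legt.
rewrite -(mkseq_nth fset0 (take n t)) size_takel 1?ltnW //.
by apply/eq_in_map => i; rewrite mem_iota => /andP[_ lti]; rewrite nth_take.
Qed.

(** If [p] were in the closure of an offered point [x], then Bob could select [x]
    alone and stop: all that he has selected would accumulate at [p]. *)
Lemma offered_points_far (X : topologicalType) (p : X) (k : nat)
    (sigma : alice_strategy X) (t : seq {fset X}) (x : X) :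
  0 < k ->
  alice_winning (Omega_at p) (fun F : {fset X} => #|` F| <= k)
    (fun B => Omega_at p (union_of_moves B)) sigma ->
  legal_position (fun F : {fset X} => #|` F| <= k) sigma t ->
  sigma t x -> ~ closure [set x] p.
Proof.
move=> k0 win legt tx px.
apply: (@legal_position_lost _ _ _ _ _ (rcons t [fset x]%fset) _ win).
- by rewrite cardfs0.
- apply: legal_position_rcons => //; last by rewrite cardfs1.
  by move=> y /=; rewrite inE => /eqP ->.
- apply: closureS px => _ ->; exists (size t) => //=.
  by rewrite nth_rcons ltnn eqxx inE.
Qed.

(** * Switching to a new strategy whenever Bob exceeds his past moves *)

(** In a state [(m, t)], [m] is the largest size of a move of Bob so far and [t]
    lists his moves after the one that first raised the record to [m] (all of
    them while [m = 0]). *)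
Definition switch_step (X : choiceType) (st : nat * seq {fset X})
    (F : {fset X}) : nat * seq {fset X} :=
  if #|` F| <= st.1 then (st.1, rcons st.2 F) else (#|` F|, [::]).

Definition switch_state (X : choiceType) : seq {fset X} -> nat * seq {fset X} :=
  foldl (@switch_step X) (0, [::]).

Definition switch_strategy (X : choiceType) (sigma : nat -> alice_strategy X) :
    alice_strategy X :=
  fun s => sigma (switch_state s).1 (switch_state s).2.

Section Run.
Variables (X : choiceType) (B : nat -> {fset X}).

Let m n := (switch_state (mkseq B n)).1.
Let t n := (switch_state (mkseq B n)).2.

Lemma switch_stateS n :
  switch_state (mkseq B n.+1) = switch_step (switch_state (mkseq B n)) (B n).
Proof. by rewrite mkseqS /switch_state foldl_rcons. Qed.

Lemma switch_bound_step n : m n <= m n.+1 /\ #|` B n| <= m n.+1.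
Proof.
rewrite /m switch_stateS /switch_step; case: (leqP #|` B _| _) => //= lt.
by split=> //; exact: ltnW.
Qed.

Lemma switch_bound_le k n : (forall i, #|` B i| <= k) -> m n <= k.
Proof.
move=> Bk; elim: n => [//|n IHn].
rewrite /m switch_stateS /switch_step; case: (leqP #|` B _| _) => _.
  exact: IHn.
exact: Bk.
Qed.

(** Take [N] to be the first inning at which the largest bound is reached: then
    the history kept at [N] is empty, and from [N] on nothing is forgotten. *)
Lemma eventually_one_strategy k :
  (forall i, #|` B i| <= k) ->
  exists N M, forall i,
    m (N + i) = M /\ t (N + i) = mkseq (fun j => B (N + j)) i.
Proof.
move=> Bk.
have exM : exists M, `[< exists n, m n = M >].
  by exists (m 0); apply/asboolP; exists 0.
have leM M : `[< exists n, m n = M >] -> M <= k.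
  by move=> /asboolP[n <-]; exact: switch_bound_le.
case: (ex_maxnP exM leM) => M /asboolP exN maxM.
have {}exN : exists n, m n == M by case: exN => n <-; exists n.
case: (ex_minnP exN) => N /eqP mN minN.
have mM n : m n <= M by apply: maxM; apply/asboolP; exists n.
have tN : t N = [::].
  case: N mN minN => [//|N] mN minN.
  move: mN; rewrite /m /t switch_stateS /switch_step.
  case: (leqP #|` B _| _) => //= _ mN.
  by have := minN N; rewrite ltnn /m mN eqxx => /(_ isT).
exists N, M; elim=> [|i [mi ti]]; first by rewrite addn0.
have BM : #|` B (N + i)| <= m (N + i).
  by rewrite mi; apply: leq_trans (switch_bound_step (N + i)).2 (mM _).
rewrite addnS /m /t switch_stateS /switch_step BM /=.
by rewrite mkseqS -ti.
Qed.

Lemma switch_position_legal (sigma : nat -> alice_strategy X) n :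
  (forall i, [set` B i] `<=` alice_move (switch_strategy sigma) B i) ->
  legal_position (fun F : {fset X} => #|` F| <= m n) (sigma (m n)) (t n).
Proof.
move=> BA; elim: n => [//|n IHn].
rewrite /m /t switch_stateS /switch_step; case: (leqP #|` B _| _) => //= Bm.
by apply: legal_position_rcons => //; exact: BA.
Qed.

End Run.

(** * The bounded game and the games with a fixed bound *)

Theorem theorem3p8 (X : topologicalType) (p : X) :
  alice_wins_Gbnd (Omega_at p) (Omega_at p) <->
  (forall k : nat, 0 < k -> alice_wins_Gk k (Omega_at p) (Omega_at p)).
Proof.
split=> [[sigma [sigmaA win]] k _|winG].
  exists sigma; split=> // B legB pB; apply: (win B) => [n|].
    by have [] := legB n.
  by split=> //; exists k => n; have [] := legB n.
have /choice[sigma winS] := fun m => winG m.+1 (ltn0Sn m).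
exists (switch_strategy sigma); split=> [s|B legB [pB [k Bk]]].
  exact: (winS _).1.
have BA n : [set` B n] `<=` alice_move (switch_strategy sigma) B n.
  by have [] := legB n.
have Bfar n : ~ closure [set` B n] p.
  move=> /closure_seq[x xB]; apply: (offered_points_far _ (winS _)) (BA n x xB).
    by [].
  move=> i /(switch_position_legal BA)[sub le].
  by split=> //; exact: leqW.
have [N [M stateN]] := eventually_one_strategy Bk.
apply: (winS M).2 (closure_tail N Bfar pB) => i; split.
  have [mi ti] := stateN i.
  by have := BA (N + i); rewrite /alice_move /switch_strategy mi ti.
have [<- _] := stateN i.+1.
by rewrite addnS; apply: leqW; exact: (switch_bound_step _ _).2.
Qed.
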